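(* Let $k\geq 1$. If $m\geq n\geq 2$ and $m\geq k$, then $\gamma_{\times k,t}(K_n\Box K_m)\leq kn$, with equality when $m\geq kn-1$. If $m\geq k+1$, then $\gamma_{\times k,t}(K_1\Box K_m)=k+1$.
   Context: $K_n$ is the complete graph on $n$ vertices and $K_n\Box K_m$ is the Cartesian product (the $n\times m$ rook's graph): vertex set $V(K_n)\times V(K_m)$, two distinct vertices adjacent iff they agree in exactly one coordinate. A $k$-tuple total dominating set of a graph is a set $S$ of vertices such that every vertex has at least $k$ neighbors in $S$; $\gamma_{\times k,t}$ denotes the minimum size of such a set. *)

(* Defs.v *)
From mathcomp Require Import all_boot.

Set Implicit Arguments.
Unset Strict Implicit.
Unset Printing Implicit Defensive.

Record sgraph := SGraph {
  svertex :> finType;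
  sedge : rel svertex;
  sedge_sym : symmetric sedge;
  sedge_irr : irreflexive sedge
}.

Section CompleteGraph.
Variable n : nat.

Definition complete_rel : rel 'I_n := fun i j => i != j.

Lemma complete_sym : symmetric complete_rel.
Proof. by move=> i j; rewrite /complete_rel eq_sym. Qed.

Lemma complete_irr : irreflexive complete_rel.
Proof. by move=> i; rewrite /complete_rel eqxx. Qed.

Definition complete_graph : sgraph := SGraph complete_sym complete_irr.

End CompleteGraph.

Section CartesianProduct.
Variables G H : sgraph.

Definition cart_rel : rel (G * H)%type := fun u v =>
  ((u.1 == v.1) && sedge u.2 v.2) || ((u.2 == v.2) && sedge u.1 v.1).

Lemma cart_sym : symmetric cart_rel.
Proof.
by move=> u v; rewrite /cart_rel !(eq_sym (u.1)) !(eq_sym (u.2)) !(sedge_sym (u.1))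
  !(sedge_sym (u.2)).
Qed.

Lemma cart_irr : irreflexive cart_rel.
Proof. by move=> u; rewrite /cart_rel !sedge_irr !andbF. Qed.

Definition cart_graph : sgraph := SGraph cart_sym cart_irr.

End CartesianProduct.

Lemma rook_adjE n m (u v : cart_graph (complete_graph n) (complete_graph m)) :
  sedge u v = (u != v) && ((u.1 == v.1) (+) (u.2 == v.2)).
Proof.
case: u v => [i j] [i' j']; rewrite /= /cart_rel /= /complete_rel xpair_eqE.
by case: (i == i'); case: (j == j').
Qed.

Section TupleTotalDomination.
Variables (k : nat) (G : sgraph).

Definition ktuple_total_dominating (S : {set G}) : bool :=
  [forall v : G, k <= #|[set w in S | sedge v w]|].

(* The value is #|G|.+1, larger than the size of any vertex set, when G has no
   k-tuple total dominating set; hence any bound of the form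
   ktuple_total_dom_number <= #|G| includes the existence of such a set. *)
Definition ktuple_total_dom_number : nat :=
  \big[minn/#|G|.+1]_(S : {set G} | ktuple_total_dominating S) #|S|.

Lemma ktuple_total_dom_number_le (S : {set G}) :
  ktuple_total_dominating S -> ktuple_total_dom_number <= #|S|.
Proof.
move=> dS; rewrite /ktuple_total_dom_number; have := mem_index_enum S.
elim: (index_enum _) => // S' r IHr; rewrite inE big_cons.
case/predU1P=> [<- | /IHr le_r]; first by rewrite dS geq_minl.
by case: ifP => // _; rewrite geq_min le_r orbT.
Qed.

Lemma ktuple_total_dom_number_witness :
  ktuple_total_dom_number <= #|G| ->
  exists2 S : {set G}, ktuple_total_dominating S & #|S| = ktuple_total_dom_number.
Proof.
rewrite /ktuple_total_dom_number.
elim/big_ind: _ => [|x y IHx IHy|S dS _]; first by rewrite ltnn.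
- by rewrite /minn; case: ifP.
- by exists S.
Qed.

End TupleTotalDomination.

(* Main.v *)
(** On the rook's graph, a vertex [(i, j)] has [r + c - 2 s] neighbours in [S],
    where [r] and [c] count the elements of [S] in row [i] and column [j], and
    [s] is 1 or 0 according to whether [(i, j)] is in [S].  The upper bounds come
    from unions of full columns.  For the lower bound [k n]: if [S] misses a whole
    column, every row contains [k] elements of [S]; otherwise [#|S| < k n] forces
    [m = k n - 1] and exactly one element of [S] per column, so a nonempty row
    has at least [k + 1] elements.  A row with fewer than [k] elements is then
    empty, whence [k = 1], which contradicts [n <= m]. *)

Require Import Defs.
From mathcomp Require Import all_boot zify.

Set Implicit Arguments.
Unset Strict Implicit.
Unset Printing Implicit Defensive.

Lemma exists_subset_card (T : finType) k :
  k <= #|T| -> exists A : {set T}, #|A| = k.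
Proof.
move=> le_k; exists [set x in take k (enum T)].
by rewrite cardsE (card_uniqP _) ?take_uniq ?enum_uniq // size_takel // -cardE.
Qed.

(** The vertex [v] has a neighbour [w] in [S], and the [k] neighbours that [w] itself needs in [S]
    all differ from [w]. *)
Lemma ktuple_total_dominating_card_gt k (G : sgraph) (v : G) (S : {set G}) :
  1 <= k -> ktuple_total_dominating k S -> k < #|S|.
Proof.
move=> k_gt0 /forallP domS.
have /card_gt0P[w]: 0 < #|[set w in S | sedge v w]| by apply: leq_trans (domS v).
rewrite inE => /andP[Sw _]; rewrite (cardsD1 w) Sw add1n ltnS.
apply: leq_trans (domS w) _; apply/subset_leq_card/subsetP=> u.
rewrite !inE => /andP[-> wu]; rewrite andbT.
by apply: contraTneq wu => ->; rewrite sedge_irr.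
Qed.

Lemma ktuple_total_dom_number_eq k (G : sgraph) (S : {set G}) :
    ktuple_total_dominating k S ->
    (forall S' : {set G}, ktuple_total_dominating k S' -> #|S| <= #|S'|) ->
  ktuple_total_dom_number k G = #|S|.
Proof.
move=> domS minS; have le_num := ktuple_total_dom_number_le domS.
(* Since [S] is dominating, the number is at most [#|G|], so it is not the default value and some
   [S'] attains it. *)
have [|S' domS' cardS'] := @ktuple_total_dom_number_witness k G.
  exact: leq_trans le_num (max_card _).
by apply/eqP; rewrite eqn_leq le_num -cardS' minS.
Qed.

Section Rook.
Variables n m : nat.
Local Notation rook := (cart_graph (complete_graph n) (complete_graph m)).
Implicit Types S : {set rook}.

Definition rook_row S (i : 'I_n) : {set rook} := [set w in S | w.1 == i].
Definition rook_col S (j : 'I_m) : {set rook} := [set w in S | w.2 == j].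

Lemma card_rook_rows S : #|S| = \sum_(i < n) #|rook_row S i|.
Proof.
rewrite -sum1_card (partition_big (fun w : rook => w.1 : 'I_n) predT) //=.
by apply: eq_bigr => i _; rewrite -sum1_card; apply: eq_bigl => w; rewrite inE.
Qed.

Lemma card_rook_cols S : #|S| = \sum_(j < m) #|rook_col S j|.
Proof.
rewrite -sum1_card (partition_big (fun w : rook => w.2 : 'I_m) predT) //=.
by apply: eq_bigr => j _; rewrite -sum1_card; apply: eq_bigl => w; rewrite inE.
Qed.

(** The neighbours of [v] in [S] form the symmetric difference of its row and column in [S], which
    can meet only at [v]. The doubled term stands on the left to avoid truncated subtraction. *)
Lemma card_rook_neighbors S (v : rook) :
  #|[set w in S | sedge v w]| + (v \in S).*2
    = #|rook_row S v.1| + #|rook_col S v.2|.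
Proof.
set A := rook_row S v.1; set B := rook_col S v.2.
have AB : #|A :&: B| = (v \in S).
  have -> : A :&: B = [set w in S | w == v].
    apply/setP=> w; rewrite !inE -pair_eqE /=.
    by case: (w \in S); case: (w.1 == v.1).
  case: (boolP (v \in S)) => Sv.
    rewrite -[RHS](cards1 v); apply: eq_card => w; rewrite !inE.
    by case: eqP => [->|]; rewrite ?Sv ?andbF.
  apply: eq_card0 => w; rewrite !inE; apply: contraNF Sv.
  by case/andP=> Sw /eqP <-.
have -> : [set w in S | sedge v w] = (A :\: B) :|: (B :\: A).
  apply/setP=> w; rewrite !inE rook_adjE -pair_eqE /= (eq_sym v.1) (eq_sym v.2).
  by case: (w \in S); case: (w.1 == v.1); case: (w.2 == v.2).
rewrite cardsU.
have -> : (A :\: B) :&: (B :\: A) = set0.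
  by apply/setP=> w; rewrite !inE; case: (w \in S); case: (_ == _); case: (_ == _).
have := cardsID B A; have := cardsID A B; rewrite setIC AB cards0; lia.
Qed.

(** A vertex outside the columns of [A] has [#|A|] neighbours in them, and a vertex inside has
    [#|A| + n - 2]: one hypothesis for each case. *)
Lemma rook_columns_dominating k (A : {set 'I_m}) :
    k <= #|A| -> k + 2 <= #|A| + n ->
  ktuple_total_dominating k (setX setT A : {set rook}).
Proof.
move=> le_kA le_kAn; apply/forallP=> -[i j].
rewrite -(leq_add2r ((i, j) \in setX setT A).*2) card_rook_neighbors.
have -> : rook_row (setX setT A) i = setX [set i] A.
  by apply/setP=> -[i' j']; rewrite !inE /= andbC.
have -> : rook_col (setX setT A) j = if j \in A then setX setT [set j] else set0.
  apply/setP=> -[i' j']; rewrite !inE /=.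
  by case: ifP => jA; rewrite !inE /=; case: eqP => [->|]; rewrite ?jA ?andbF.
rewrite cardsX cards1 mul1n !inE /=.
case: ifP => _; last by rewrite cards0 !addn0.
by rewrite cardsX cardsT card_ord cards1 muln1.
Qed.

Lemma rook_total_dominating_card_ge k S :
    1 <= k -> n <= m -> k * n - 1 <= m -> ktuple_total_dominating k S ->
  k * n <= #|S|.
Proof.
move=> k_gt0 le_nm le_knm /forallP domS; rewrite leqNgt; apply/negP=> ltS.
have dom i j : k + (((i, j) : rook) \in S).*2 <= #|rook_row S i| + #|rook_col S j|.
  by rewrite -(card_rook_neighbors S (i, j)) leq_add2r; apply: domS.
have [i ltSi] : exists i, #|rook_row S i| < k.
  apply/existsP; apply: contraLR ltS => /existsPn geS.
  rewrite -leqNgt card_rook_rows mulnC -{1}(card_ord n) -sum_nat_const.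
  by apply: leq_sum => i _; rewrite leqNgt geS.
have col_gt0 j : 0 < #|rook_col S j| by have := dom i j; lia.
have leS : m <= #|S|.
  rewrite card_rook_cols -{1}(card_ord m) -sum1_card.
  by apply: leq_sum => j _; apply: col_gt0.
(* From [m <= #|S| < k * n] and [k * n - 1 <= m] it follows that [#|S| = m]; so [m] positive column
   sizes add up to [m], and each is 1. *)
have col1 j : #|rook_col S j| = 1.
  have [_] := leqif_sum (fun j (_ : predT j) => leqif_eq (col_gt0 j)).
  rewrite sum1_card card_ord -card_rook_cols.
  have -> : m == #|S| by lia.
  by move=> /esym/forallP/(_ j)/eqP.
(* An element of [S] in row [i] would force [k + 2 <= #|rook_row S i| + 1], against the choice of
   [i]. *)
have row0 : #|rook_row S i| = 0.
  apply/eqP; rewrite cards_eq0; apply/set0Pn=> -[[i' j]].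
  rewrite !inE /= => /andP[Sij /eqP ii']; subst i'.
  by have := dom i j; rewrite Sij col1; move: ltSi => /=; lia.
have m_gt0 : 0 < m by have := ltn_ord i; lia.
have := dom i (Ordinal m_gt0); rewrite row0 col1 => le_k1.
have k1 : k = 1 by lia.
(* Now [#|S| < n <= m <= #|S|]. *)
by move: ltS; rewrite k1; lia.
Qed.

End Rook.

Theorem theorem6 (k : nat) (k_ge1 : 1 <= k) :
  (forall m n : nat, n <= m -> 2 <= n -> k <= m ->
     ktuple_total_dom_number k (cart_graph (complete_graph n) (complete_graph m))
       <= k * n
     /\ (k * n - 1 <= m ->
         ktuple_total_dom_number k
           (cart_graph (complete_graph n) (complete_graph m)) = k * n))
  /\ (forall m : nat, k + 1 <= m ->
        ktuple_total_dom_number k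
          (cart_graph (complete_graph 1) (complete_graph m)) = k + 1).
Proof.
split=> [m n le_nm n_ge2 le_km | m lt_km].
  have [|A cardA] := @exists_subset_card 'I_m k; first by rewrite card_ord.
  have domA : ktuple_total_dominating k
      (setX setT A : {set cart_graph (complete_graph n) (complete_graph m)}).
    by apply: rook_columns_dominating; lia.
  have cardX : #|setX [set: 'I_n] A| = k * n.
    by rewrite cardsX cardsT card_ord cardA mulnC.
  split=> [|le_knm]; first by rewrite -cardX ktuple_total_dom_number_le.
  rewrite -cardX; apply: ktuple_total_dom_number_eq => // S domS.
  by rewrite cardX rook_total_dominating_card_ge.
(* In a single row, a vertex of the set is not its own neighbour and its column offers no other, so
   one more column than [k] is taken. *)
have [|A cardA] := @exists_subset_card 'I_m (k + 1); first by rewrite card_ord.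
have domA : ktuple_total_dominating k
    (setX setT A : {set cart_graph (complete_graph 1) (complete_graph m)}).
  by apply: rook_columns_dominating; lia.
have cardX : #|setX [set: 'I_1] A| = k + 1.
  by rewrite cardsX cardsT card_ord cardA mul1n.
have m_gt0 : 0 < m by lia.
rewrite -cardX; apply: ktuple_total_dom_number_eq => // S domS.
rewrite cardX addn1.
exact: (ktuple_total_dominating_card_gt
  ((ord0, Ordinal m_gt0) : cart_graph (complete_graph 1) (complete_graph m))).
Qed.
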